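(* Let $M$ be a Riemannian manifold, let $R$ be a retraction on $M$, and let $f:M\to\mathbb{R}$ be a smooth function that is bounded below and for which there exists $L>0$ such that $$\left|\mathrm{D}(f\circ R_x)(t\eta)[\eta]-\mathrm{D}(f\circ R_x)(0_x)[\eta]\right|\le Lt$$ for all $x\in M$, all $\eta\in T_xM$ with $\|\eta\|_x=1$, and all $t\ge0$. Let $0<c_1<c_2<1/2$. Let $\{x_k\}_{k=0,1,\dots}\subset M$, with search directions $\eta_k\in T_{x_k}M$, step sizes $\alpha_k>0$ and parameters $\beta_{k+1}\in\mathbb{R}$, be any sequence generated by the Riemannian conjugate gradient iteration described in the context. Write $g_k:=\operatorname{grad} f(x_k)$. Suppose that each $\alpha_k>0$ satisfies the strong Wolfe conditions $$f(R_{x_k}(\alpha_k\eta_k))\le f(x_k)+c_1\alpha_k\langle g_k,\eta_k\rangle_{x_k},$$ $$\left|\left\langle \operatorname{grad} f(R_{x_k}(\alpha_k\eta_k)),\,\mathrm{D}R_{x_k}(\alpha_k\eta_k)[\eta_k]\right\rangle_{R_{x_k}(\alpha_k\eta_k)}\right|\le c_2\left|\langle g_k,\eta_k\rangle_{x_k}\right|,$$ and that each $\beta_{k+1}$ satisfies $$|\beta_{k+1}|\le \beta^{\mathrm{FR}}_{k+1}:=\frac{\|g_{k+1}\|_{x_{k+1}}^2}{\|g_k\|_{x_k}^2}.$$ Then $$\liminf_{k\to\infty}\|g_k\|_{x_k}=0.$$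
   Context: For a Riemannian manifold $M$, $\langle\cdot,\cdot\rangle_x$ denotes the Riemannian metric on $T_xM$, $\|\cdot\|_x$ the induced norm, and $\operatorname{grad} f(x)\in T_xM$ the Riemannian gradient of $f$ at $x$. $\mathrm{D}F(x)$ denotes the differential of a smooth map $F$ at $x$. A retraction on $M$ is a smooth map $R:TM\to M$ such that, with $R_x:=R|_{T_xM}$, one has for every $x\in M$: $R_x(0_x)=x$, where $0_x$ is the zero element of $T_xM$; and, under the canonical identification $T_{0_x}T_xM\simeq T_xM$, $\mathrm{D}R_x(0_x)[\xi]=\xi$ for all $\xi\in T_xM$. For $x\in M$ and $\eta,\xi\in T_xM$, the differentiated retraction is $\mathcal{T}^R_\eta(\xi):=\mathrm{D}R_x(\eta)[\xi]\in T_{R_x(\eta)}M$ (identifying $T_\eta T_xM\simeq T_xM$). The scaled vector transport with respect to $R$ is $$\mathcal{T}^S_\eta(\xi):=\begin{cases}\mathcal{T}^R_\eta(\xi), & \text{if } \|\mathcal{T}^R_\eta(\xi)\|_{R_x(\eta)}\le\|\xi\|_x,\\[4pt] \dfrac{\|\xi\|_x}{\|\mathcal{T}^R_\eta(\xi)\|_{R_x(\eta)}}\,\mathcal{T}^R_\eta(\xi), & \text{otherwise.}\end{cases}$$ Riemannian conjugate gradient iteration: given an initial point $x_0\in M$, set $g_0:=\operatorname{grad} f(x_0)$ and $\eta_0:=-g_0$. For $k=0,1,\dots$, choose a step size $\alpha_k>0$, set $x_{k+1}:=R_{x_k}(\alpha_k\eta_k)$ and $g_{k+1}:=\operatorname{grad}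 f(x_{k+1})$, choose a parameter $\beta_{k+1}\in\mathbb{R}$, and set $$\eta_{k+1}:=-g_{k+1}+\beta_{k+1}\mathcal{T}^S_{\alpha_k\eta_k}(\eta_k).$$ If $g_{k_0}=0$ for some $k_0$, the iteration stops at $k_0$ (no conditions are imposed beyond that index) and the sequence is regarded as constant from then on, $x_k=x_{k_0}$ for $k\ge k_0$; otherwise the iteration runs for all $k$. *)

(* Defs.v *)
From HB Require Import structures.
From mathcomp Require Import all_boot all_order all_algebra.
From mathcomp Require Import all_classical all_reals all_analysis.
Import Order.TTheory GRing.Theory Num.Theory.
Import numFieldNormedType.Exports.

Set Implicit Arguments.
Unset Strict Implicit.
Unset Printing Implicit Defensive.

Local Open Scope classical_set_scope.
Local Open Scope ring_scope.

Section SmoothMaps.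
Variables (R : realType) (V W : normedModType R).

(* Meant for [U] open and [V] finite-dimensional: asking that every directional
   derivative of [f] be C^k is then the same as asking that [x |-> 'd f x] be
   C^k. *)
Fixpoint Ck_on (k : nat) (U : set V) (f : V -> W) : Prop :=
  match k with
  | 0 => {in U, continuous f}
  | k'.+1 => {in U, forall x, differentiable f x} /\
             forall v : V, Ck_on k' U (fun x => 'd f x v)
  end.

Definition smooth_on (U : set V) (f : V -> W) : Prop := forall k, Ck_on k U f.

End SmoothMaps.

(* Only the values of [cmap] on [cdom] and of [cinv] on [cimg] are meaningful. *)
Record chart (R : realType) (M : topologicalType) (n : nat) := Chart {
  cdom : set M;
  cmap :> M -> 'rV[R]_n;
  cinv : 'rV[R]_n -> M;
  cdom_open : open cdom;
  cimg_open : open (cmap @` cdom);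
  cmapK : {in cdom, cancel cmap cinv};
  cmap_continuous : {in cdom, continuous cmap};
  cinv_continuous : {in cmap @` cdom, continuous cinv}
}.

Definition cimg (R : realType) (M : topologicalType) (n : nat)
  (c : chart R M n) : set 'rV[R]_n := c @` cdom c.

(* A smooth manifold of dimension [n], together with the choice of a chart
   [atlas (chart_at x)] around each point [x].  The choice carries no geometry:
   it only fixes coordinates on the tangent spaces.  An element of T_x M is
   represented by its coordinate vector in the chart chosen at [x], so that
   every T_x M is the type ['rV[R]_n]; its coordinates in another chart are
   obtained by applying the differential of the transition map. *)
Record smooth_manifold (R : realType) (n : nat) := SmoothManifold {
  carrier :> topologicalType;
  carrier_hausdorff : hausdorff_space carrier;
  carrier_second_countable : @second_countable carrier;
  chart_index : Type;
  atlas : chart_index -> chart R carrier n;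
  chart_at : carrier -> chart_index;
  mem_chart_at : forall x, cdom (atlas (chart_at x)) x;
  transition_smooth : forall i j,
    smooth_on (cimg (atlas i) `&` cinv (atlas i) @^-1` cdom (atlas j))
              (atlas j \o cinv (atlas i))
}.

Section Manifold.
Variables (R : realType) (n : nat) (M : smooth_manifold R n).

Definition chartx (x : M) : chart R M n := atlas (chart_at x).

(* The tangent vector at [x = cinv (atlas i) y] whose coordinates in the chart
   [i] are [v]. *)
Definition tvec (i : chart_index M) (y v : 'rV[R]_n) : 'rV[R]_n :=
  'd (chartx (cinv (atlas i) y) \o cinv (atlas i)) y v.

Definition smooth_fun (f : M -> R) : Prop :=
  forall i : chart_index M, smooth_on (cimg (atlas i)) (f \o cinv (atlas i)).

(* Smoothness of an M-valued map on an open set [U] of a normed space. *)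
Definition smooth_into (V : normedModType R) (U : set V) (F : V -> M) : Prop :=
  {in U, continuous F} /\
  forall j : chart_index M,
    smooth_on (U `&` F @^-1` cdom (atlas j)) (atlas j \o F).

(* D f(x) : T_x M -> R *)
Definition dfun (f : M -> R) (x : M) (v : 'rV[R]_n) : R :=
  'd (f \o cinv (chartx x)) (chartx x x) v.

(* D F(eta) : R^n -> T_(F eta) M *)
Definition dinto (F : 'rV[R]_n -> M) (eta xi : 'rV[R]_n) : 'rV[R]_n :=
  'd (chartx (F eta) \o F) eta xi.

Record riemannian_metric := RiemannianMetric {
  metric :> M -> 'rV[R]_n -> 'rV[R]_n -> R;
  metric_linear : forall x (a : R) (u v w : 'rV[R]_n),
    metric x (a *: u + v) w = a * metric x u w + metric x v w;
  metric_sym : forall x u v, metric x u v = metric x v u;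
  metric_gt0 : forall x u, u != 0 -> 0 < metric x u u;
  metric_smooth : forall (i : chart_index M) (v w : 'rV[R]_n),
    smooth_on (cimg (atlas i))
      (fun y => metric (cinv (atlas i) y) (tvec i y v) (tvec i y w))
}.

(* [retr_smooth] is smoothness on TM, written in the charts (y, v) of TM
   induced by those of M. *)
Record retraction := Retraction {
  retr :> M -> 'rV[R]_n -> M;
  retr_smooth : forall i : chart_index M,
    smooth_into [set yv : 'rV[R]_n * 'rV[R]_n | cimg (atlas i) yv.1]
      (fun yv => retr (cinv (atlas i) yv.1) (tvec i yv.1 yv.2));
  retr0 : forall x, retr x 0 = x;
  dretr0 : forall x xi, dinto (retr x) 0 xi = xi
}.

Variables (g : riemannian_metric) (Rt : retraction).

Definition rnorm (x : M) (u : 'rV[R]_n) : R := Num.sqrt (g x u u).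

Definition grad (f : M -> R) (x : M) : 'rV[R]_n :=
  xget 0 [set u | forall v, g x u v = dfun f x v].

Definition transport (x : M) (eta xi : 'rV[R]_n) : 'rV[R]_n :=
  dinto (Rt x) eta xi.

Definition scaled_transport (x : M) (eta xi : 'rV[R]_n) : 'rV[R]_n :=
  let t := transport x eta xi in
  if rnorm (Rt x eta) t <= rnorm x xi then t
  else (rnorm x xi / rnorm (Rt x eta) t) *: t.

(* Once [grad f (x k) = 0], the sequence [x] stays constant and the other
   sequences are unconstrained. *)
Definition rcg_iteration (f : M -> R) (x : nat -> M) (eta : nat -> 'rV[R]_n)
    (alpha beta : nat -> R) : Prop :=
  eta 0%N = - grad f (x 0%N) /\
  forall k,
    (grad f (x k) = 0 -> x k.+1 = x k) /\
    (grad f (x k) <> 0 ->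
      [/\ 0 < alpha k,
          x k.+1 = Rt (x k) (alpha k *: eta k) &
          eta k.+1 = - grad f (x k.+1)
            + beta k.+1 *: scaled_transport (x k) (alpha k *: eta k) (eta k)]).

Definition strong_wolfe (f : M -> R) (c1 c2 : R) (x : M) (eta : 'rV[R]_n)
    (alpha : R) : Prop :=
  let x' := Rt x (alpha *: eta) in
  f x' <= f x + c1 * alpha * g x (grad f x) eta /\
  `|g x' (grad f x') (transport x (alpha *: eta) eta)|
    <= c2 * `|g x (grad f x) eta|.

Definition beta_FR (f : M -> R) (x x' : M) : R :=
  rnorm x' (grad f x') ^+ 2 / rnorm x (grad f x) ^+ 2.

End Manifold.

(* Main.v *)
(* The chain rule turns D(f o R_x)(xi)[v] into <grad f(R_x xi), DR_x(xi)[v]>, so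
   the curvature condition bounds <g_(k+1), T^S eta_k> by c2 |<g_k, eta_k>|
   (scaling only shrinks the transported vector).  With |beta| <= beta^FR,
   induction gives |<g_k, eta_k> + |g_k|^2| <= c2 / (1 - c2) |g_k|^2, hence
   sufficient descent since c2 < 1/2, and then
     |eta_(k+1)|^2 <= (1 + c2) / (1 - c2) |g_(k+1)|^2 + beta_FR^2 |eta_k|^2.
   If |g_k| stays above e > 0, then r_k := |eta_k|^2 / |g_k|^4 grows at most
   linearly.  The Lipschitz and Wolfe conditions make f decrease at each step by
   at least a multiple of <g_k, eta_k>^2 / |eta_k|^2 >= const / r_k, so by the
   divergence of the harmonic series f is unbounded below. *)
Require Import Defs.
From mathcomp Require Import all_boot all_order all_algebra.
From mathcomp Require Import all_classical all_reals all_analysis.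
From mathcomp Require Import ring lra.
Import Order.TTheory GRing.Theory Num.Theory.
Import numFieldNormedType.Exports.

Set Implicit Arguments.
Unset Strict Implicit.
Unset Printing Implicit Defensive.

Local Open Scope classical_set_scope.
Local Open Scope ring_scope.

(** The first-order expansion at [x] depends only on values near [x]. Chart inverse identities hold
    only locally, and differentials are carried across them this way. *)
Lemma near_eq_differentiable_diff (R : numFieldType) (V W : normedModType R)
    (f h : V -> W) (x : V) :
  (\near x, f x = h x) -> differentiable f x ->
  differentiable h x /\ 'd h x = 'd f x :> (V -> W).
Proof.
move=> fh df; have [dfc dfo] := (diff_locallyP _ _).1 df.
have ho : h \o shift x = cst (h x) + 'd f x +o_ 0 id.
  apply/eqaddoP => e e0; move/eqaddoP: dfo => /(_ e e0) dfo.
  have fhx0 : f x = h x by exact: nbhs_singleton fh.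
  move: fh; rewrite (near_shift 0) => fh.
  apply: filterS2 fh dfo => y; rewrite /= !fctE /= subr0 => fhy.
  by rewrite fhy fhx0.
have dhE : 'd h x = 'd f x :> (V -> W) by exact: diff_unique.
split; last exact: dhE.
by apply/diff_locallyP; rewrite dhE; split; [exact: dfc|exact: ho].
Qed.

(** * Retractions in charts and the chain rule *)

Section Geometry.
Variables (R : realType) (n : nat) (M : smooth_manifold R n).
Variables (Rt : retraction M).
Local Notation chx := (@chartx R n M).

Lemma chartxK (x : M) : cinv (chx x) (chx x x) = x.
Proof. by apply: cmapK; rewrite inE; exact: mem_chart_at. Qed.

Lemma cimg_chartx (x : M) : cimg (chx x) (chx x x).
Proof. by exists x => //; exact: mem_chart_at. Qed.

(** Near [chx x x] the transition map from the chosen chart to itself is the identity. *)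
Lemma tvec_chartx (x : M) (v : 'rV[R]_n) : tvec (chart_at x) (chx x x) v = v.
Proof.
rewrite /tvec -/(chartx x) chartxK.
have [|_ ->] := @near_eq_differentiable_diff _ _ _ id
    (chx x \o cinv (chx x)) (chx x x) _ (@ex_diff _ _ _ _ _ _ _ _); last first.
  by rewrite diff_val.
apply: filterS
  (open_nbhs_nbhs (conj (@cimg_open _ _ _ (chx x)) (cimg_chartx x))).
by move=> _ [z zx <-] /=; rewrite cmapK ?inE.
Qed.

(** Puts [Rt x] in the form used by [retr_smooth], with the base coordinates frozen, so that
    smoothness on TM restricts to the fibre. *)
Lemma retr_chartE (x : M) (v : 'rV[R]_n) :
  Rt x v = Rt (cinv (chx x) (chx x x)) (tvec (chart_at x) (chx x x) v).
Proof. by rewrite tvec_chartx chartxK. Qed.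

Lemma continuous_retr (x : M) : continuous (Rt x : 'rV[R]_n -> M).
Proof.
move=> v; have [Fc _] := retr_smooth Rt (chart_at x).
have -> : (Rt x : _ -> _) =
    (fun yv : 'rV[R]_n * 'rV[R]_n =>
       Rt (cinv (chx x) yv.1) (tvec (chart_at x) yv.1 yv.2))
      \o (fun v => (chx x x, v)).
  by apply/funext => w; exact: retr_chartE.
apply: continuous_comp; last by apply: Fc; rewrite inE; exact: cimg_chartx.
apply: differentiable_continuous; exact: differentiable_pair.
Qed.

Lemma differentiable_retr (x : M) (xi : 'rV[R]_n) :
  differentiable (chx (Rt x xi) \o Rt x) xi.
Proof.
have [_ /(_ (chart_at (Rt x xi)) 1%N) [Fd _]] := retr_smooth Rt (chart_at x).
have -> : chx (Rt x xi) \o Rt x =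
    (chx (Rt x xi) \o
     (fun yv : 'rV[R]_n * 'rV[R]_n =>
       Rt (cinv (chx x) yv.1) (tvec (chart_at x) yv.1 yv.2)))
      \o (fun v => (chx x x, v)).
  by apply/funext => w /=; rewrite -retr_chartE.
apply: differentiable_comp; first by apply: differentiable_pair.
apply: Fd; rewrite inE; split; first exact: cimg_chartx.
by rewrite /= -retr_chartE; exact: mem_chart_at.
Qed.

(** The map [f \o Rt x] factors through the chart at [Rt x xi] only where [Rt x] stays in the chart
    domain; continuity of [Rt x] ensures this near [xi]. *)
Lemma diff_comp_retr (f : M -> R) (x : M) (xi v : 'rV[R]_n) : smooth_fun f ->
  'd (f \o Rt x) xi v = dfun f (Rt x xi) (dinto (Rt x) xi v).
Proof.
move=> fs; set y := Rt x xi.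
have [fd _] := fs (chart_at y) 1%N.
have {}fd : differentiable (f \o cinv (chx y)) ((chx y \o Rt x) xi).
  by apply: fd; rewrite inE; exact: cimg_chartx.
have Rd := differentiable_retr x xi.
have -> : dfun f y (dinto (Rt x) xi v) =
    'd ((f \o cinv (chx y)) \o (chx y \o Rt x)) xi v.
  by rewrite (diff_comp Rd fd).
have [|_ ->] := @near_eq_differentiable_diff _ _ _
  ((f \o cinv (chx y)) \o (chx y \o Rt x)) (f \o Rt x) xi _
  (differentiable_comp Rd fd); last by [].
have : nbhs xi (Rt x @^-1` cdom (chx y)).
  apply: continuous_retr; apply: open_nbhs_nbhs; split; first exact: cdom_open.
  exact: mem_chart_at.
by apply: filterS => w /= yw; rewrite cmapK ?inE.
Qed.

(** * Metric algebra, gradient and scaled transport *)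

Variable g : riemannian_metric M.

Lemma metricDl x u v w : g x (u + v) w = g x u w + g x v w.
Proof. by rewrite -[u]scale1r metric_linear mul1r scale1r. Qed.
Lemma metric0l x w : g x 0 w = 0.
Proof. by have := metricDl x 0 0 w; rewrite addr0; lra. Qed.
Lemma metricZl x a u w : g x (a *: u) w = a * g x u w.
Proof. by rewrite -[a *: u]addr0 metric_linear metric0l addr0. Qed.
Lemma metricNl x u w : g x (- u) w = - g x u w.
Proof. by rewrite -scaleN1r metricZl mulN1r. Qed.
Lemma metricDr x u v w : g x w (u + v) = g x w u + g x w v.
Proof. by rewrite Defs.metric_sym metricDl !(Defs.metric_sym _ _ w). Qed.
Lemma metricZr x a u w : g x w (a *: u) = a * g x w u.
Proof. by rewrite Defs.metric_sym metricZl (Defs.metric_sym _ _ w). Qed.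
Lemma metricNr x u w : g x w (- u) = - g x w u.
Proof. by rewrite Defs.metric_sym metricNl (Defs.metric_sym _ _ w). Qed.
Lemma metric_ge0 x u : 0 <= g x u u.
Proof. by have [->|/(metric_gt0 g x)/ltW//] := eqVneq u 0; rewrite metric0l. Qed.
Lemma rnorm_sqr x u : rnorm g x u ^+ 2 = g x u u.
Proof. by rewrite sqr_sqrtr ?metric_ge0. Qed.
Lemma rnormZ x a u : rnorm g x (a *: u) = `|a| * rnorm g x u.
Proof.
by rewrite /rnorm metricZl metricZr mulrA -expr2 sqrtrM ?sqr_ge0// sqrtr_sqr.
Qed.
Lemma rnorm_gt0 x u : u != 0 -> 0 < rnorm g x u.
Proof. by move=> /(metric_gt0 g x); rewrite sqrtr_gt0. Qed.

Lemma metric_suml x (I : finType) (F : I -> 'rV[R]_n) w :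
  g x (\sum_i F i) w = \sum_i g x (F i) w.
Proof.
elim/big_ind2 : _ => [|a b c d <- <-|//]; by [rewrite metric0l|rewrite metricDl].
Qed.

Lemma metric_sumr x (I : finType) (F : I -> 'rV[R]_n) w :
  g x w (\sum_i F i) = \sum_i g x w (F i).
Proof. rewrite Defs.metric_sym metric_suml.
by apply: eq_bigr => i _; exact: Defs.metric_sym. Qed.

Lemma metric_gradE (f : M -> R) (x : M) (v : 'rV[R]_n) :
  g x (grad g f x) v = dfun f x v.
Proof.
(* [grad] falls back on the default 0 only if no vector represents the differential; this case is to
   be excluded. *)
rewrite /grad; case: xgetP => [u _ ->//|noU]; exfalso.
(* Riesz: the Gram matrix [G] of the metric at [x] is invertible. *)
pose G : 'M[R]_n := \matrix_(i, j) g x 'e_i 'e_j.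
have GE (u w : 'rV[R]_n) : (u *m G *m w^T) 0 0 = g x u w.
  rewrite [in RHS](row_sum_delta u) [in RHS](row_sum_delta w) metric_suml.
  under [RHS]eq_bigr => i _ do rewrite metric_sumr.
  rewrite exchange_big mxE; apply: eq_bigr => j _; rewrite !mxE mulr_suml.
  apply: eq_bigr => i _; rewrite !mxE metricZl metricZr; ring.
(* A vector in the kernel of [G] has zero norm, so it vanishes by positive definiteness. *)
have Gfree : row_free G.
  rewrite -kermx_eq0; apply/rowV0P => u /sub_kermxP uG.
  apply/eqP/contraT => /(metric_gt0 g x).
  by rewrite -GE uG mul0mx mxE ltxx.
pose d : 'rV[R]_n := \row_i dfun f x 'e_i.
apply: (noU (d *m invmx G)) => w /=.
rewrite -GE mulmxKV -?row_free_unit // mxE.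
rewrite [in RHS](row_sum_delta w) /dfun linear_sum; apply: eq_bigr => i _.
by rewrite !mxE linearZ mulrC.
Qed.

Lemma diff_comp_retr_grad (f : M -> R) (x : M) (xi v : 'rV[R]_n) :
  smooth_fun f ->
  'd (f \o Rt x) xi v = g (Rt x xi) (grad g f (Rt x xi)) (transport Rt x xi v).
Proof. by move=> fs; rewrite metric_gradE diff_comp_retr. Qed.

Lemma diff_comp_retr0 (f : M -> R) (x : M) (v : 'rV[R]_n) : smooth_fun f ->
  'd (f \o Rt x) 0 v = g x (grad g f x) v.
Proof. by move=> fs; rewrite diff_comp_retr_grad // /transport dretr0 retr0. Qed.

(** Treats both branches of the scaling at once: later estimates only see a factor in [0, 1] and the
    norm bound. *)
Lemma scaled_transportP (x : M) (xi v : 'rV[R]_n) :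
  exists a, [/\ 0 <= a, a <= 1,
    scaled_transport g Rt x xi v = a *: transport Rt x xi v &
    rnorm g (Rt x xi) (scaled_transport g Rt x xi v) <= rnorm g x v].
Proof.
rewrite /scaled_transport; case: ifPn => [le_tv|].
  by exists 1; rewrite scale1r.
rewrite -ltNge => lt_vt; set t := transport _ _ _ _ in lt_vt *.
have v0 : 0 <= rnorm g x v by exact: sqrtr_ge0.
have t0 : 0 < rnorm g (Rt x xi) t by exact: le_lt_trans lt_vt.
have a0 : 0 <= rnorm g x v / rnorm g (Rt x xi) t by rewrite divr_ge0 // ltW.
exists (rnorm g x v / rnorm g (Rt x xi) t); split=> //.
  by rewrite ler_pdivrMr // mul1r ltW.
by rewrite rnormZ ger0_norm // divfK // gt_eqF.
Qed.

End Geometry.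

(** * Estimates for one step of the iteration *)

Section Step.
Variables (R : realType) (n : nat) (M : smooth_manifold R n).
Variables (g : riemannian_metric M) (Rt : retraction M) (f : M -> R).
Hypothesis f_smooth : smooth_fun f.
Local Notation gr := (grad g f).

(** Let [s] and [w] be the slopes along [eta] at 0 and at [alpha]. The Lipschitz bound for the
    normalized direction gives [w - s <= L * alpha * |eta|^2], and curvature gives [w >= c2 * s].
    Hence [alpha] is at least [(1 - c2) * - s / (L * |eta|^2)], which the Armijo condition turns
    into a decrease of [f]. *)
Lemma wolfe_decrease (L c1 c2 : R) (y : M) (eta : 'rV[R]_n) (alpha : R) :
  0 < L ->
  (forall (u : 'rV[R]_n) (t : R), rnorm g y u = 1 -> 0 <= t ->
      `|'d (f \o Rt y) (t *: u) u - 'd (f \o Rt y) 0 u| <= L * t) ->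
  0 < c1 -> 0 < alpha -> g y (gr y) eta < 0 ->
  strong_wolfe g Rt f c1 c2 y eta alpha ->
  f (Rt y (alpha *: eta)) <=
    f y - c1 * (1 - c2) / L * (g y (gr y) eta ^+ 2 / g y eta eta).
Proof.
move=> L0 lip c1_gt0 alpha0 s0 [armijo curv].
have eta0 : eta != 0.
  by apply: contraTneq s0 => ->; rewrite Defs.metric_sym metric0l ltxx.
have N0 := rnorm_gt0 g y eta0; set N := rnorm g y eta in N0.
have NN : N ^+ 2 = g y eta eta by exact: rnorm_sqr.
have u1 : rnorm g y (N^-1 *: eta) = 1.
  by rewrite rnormZ gtr0_norm ?invr_gt0// mulVf // gt_eqF.
have tu : (alpha * N) *: (N^-1 *: eta) = alpha *: eta.
  by rewrite scalerA mulfK // gt_eqF.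
have diffZ xi : 'd (f \o Rt y) xi (N^-1 *: eta) = N^-1 * 'd (f \o Rt y) xi eta.
  exact: linearZ.
have dw := diff_comp_retr_grad Rt g y (alpha *: eta) eta f_smooth.
have ds := diff_comp_retr0 Rt g y eta f_smooth.
have := lip _ (alpha * N) u1 (ltW (mulr_gt0 alpha0 N0)).
rewrite tu.
rewrite [X in `|X - _|]diffZ.
rewrite [X in `|_ - X|]diffZ.
rewrite [X in `|_ * X - _|]dw.
rewrite [X in `|_ - _ * X|]ds.
set w := g _ _ _ in curv *; set s := g y _ _ in s0 armijo curv *.
rewrite -mulrBr normrM gtr0_norm ?invr_gt0// mulrC ler_pdivrMr // => slope.
have {}slope : w - s <= L * alpha * g y eta eta.
  by rewrite -NN expr2 !mulrA (le_trans (ler_norm _))// -(mulrA L).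
have {}curv : c2 * s <= w.
  by move: curv; rewrite (ltr0_norm s0) mulrN ler_norml opprK => /andP[].
apply: le_trans armijo _; rewrite lerD2l.
move: slope (metric_gt0 g y eta0); move: (g y eta eta) => H slope H0.
clearbody s w; clear lip NN u1 tu diffZ dw ds N0 N.
have step : (1 - c2) * - s / (L * H) <= alpha.
  by rewrite ler_pdivrMr ?mulr_gt0//; nra.
have -> : - (c1 * (1 - c2) / L * (s ^+ 2 / H)) =
    c1 * ((1 - c2) * - s / (L * H)) * s by field; rewrite !gt_eqF.
by rewrite ler_nM2r // ler_pM2l.
Qed.

(** The induction step on bare vectors: [p], [p'] are successive gradients, [v] is the transported
    direction, [a] its scaling. The descent bound, with the denominator [1 - c2] cleared, reproduces
    itself because the bound on [beta] trades [g y p p] for [g y' p' p']. *)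
Lemma metric_conjugate_direction (y y' : M) (p eta p' v : 'rV[R]_n)
    (c2 a beta : R) :
  let eta' := - p' + beta *: (a *: v) in
  0 <= c2 -> c2 < 1 / 2 -> p != 0 -> 0 <= a -> a <= 1 ->
  g y' (a *: v) (a *: v) <= g y eta eta ->
  `|g y' p' v| <= c2 * `|g y p eta| ->
  `|beta| <= g y' p' p' / g y p p ->
  (1 - c2) * `|g y p eta + g y p p| <= c2 * g y p p ->
  (1 - c2) * `|g y' p' eta' + g y' p' p'| <= c2 * g y' p' p' /\
  g y' eta' eta' <= (1 + c2) / (1 - c2) * g y' p' p'
    + (g y' p' p' / g y p p) ^+ 2 * g y eta eta.
Proof.
move=> eta' c20 c2h p0 a0 a1 TT curv lebeta descent; rewrite /eta' {eta'}.
move: lebeta descent (metric_gt0 g y p0) (metric_ge0 g y' p').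
rewrite !metricDr !metricNr !metricDl !metricNl.
rewrite !(metricZr _ _ beta) !(metricZl _ _ beta) (Defs.metric_sym g y' (a *: v) p').
move: TT (metric_ge0 g y' (a *: v)); move: (g y' (a *: v) (a *: v)) => TT.
rewrite metricZr; move: (g y' p' v) (g y p eta) (g y p p) (g y' p' p')
  (g y eta eta) curv.
move=> w s G G' H curv TH T0 lebeta descent G0 G0'.
(* As [c2 < 1 - c2], descent forces [s <= 0], and then [- s <= G + c2 / (1 - c2) * G = G / (1 -
   c2)]. *)
have normS : (1 - c2) * `|s| <= G.
  have := ler_norm (s + G); have := ler_norm (- (s + G)); rewrite normrN => h1 h2.
  have s0 : s <= 0 by nra.
  by rewrite ler0_norm //; nra.
have normw : (1 - c2) * `|a * w| <= c2 * G.
  rewrite normrM (ger0_norm a0).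
  have : a * `|w| <= `|w| by rewrite ler_piMl.
  nra.
move: (a * w) normw => {curv}w normw.
have bw : (1 - c2) * `|beta * w| <= c2 * G'.
  rewrite normrM mulrCA.
  have -> : c2 * G' = G' / G * (c2 * G) by field; rewrite gt_eqF.
  by apply: ler_pM; rewrite ?mulr_ge0//; lra.
split; first by have -> : - G' + beta * w + G' = beta * w by ring.
have b2 : beta ^+ 2 <= (G' / G) ^+ 2.
  by rewrite -(real_normK (num_real beta)) ler_sqr ?nnegrE// divr_ge0// ltW.
have bT : beta ^+ 2 * TT <= (G' / G) ^+ 2 * H.
  by apply: ler_pM; rewrite ?sqr_ge0.
have bw' : - (beta * w) <= c2 * G' / (1 - c2).
  rewrite ler_pdivlMr; last by lra.
  by have := ler_norm (- (beta * w)); rewrite normrN; nra.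
(* The first summand is the square of [p'], the second bounds the cross term [- 2 * (beta * w)]. *)
have -> : (1 + c2) / (1 - c2) * G' = G' + 2 * (c2 * G' / (1 - c2)).
  by field; rewrite gt_eqF //; lra.
move: (_ ^+ 2 * H) bT => ?; move: (_ / (1 - c2)) bw' => ? *; lra.
Qed.

Lemma rcg_next_direction (c1 c2 : R) (y y' : M) (eta eta' : 'rV[R]_n)
    (alpha beta : R) :
  y' = Rt y (alpha *: eta) ->
  0 <= c2 -> c2 < 1 / 2 -> gr y <> 0 ->
  strong_wolfe g Rt f c1 c2 y eta alpha ->
  `|beta| <= beta_FR g f y y' ->
  eta' = - gr y' + beta *: scaled_transport g Rt y (alpha *: eta) eta ->
  (1 - c2) * `|g y (gr y) eta + g y (gr y) (gr y)| <= c2 * g y (gr y) (gr y) ->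
  (1 - c2) * `|g y' (gr y') eta' + g y' (gr y') (gr y')|
    <= c2 * g y' (gr y') (gr y') /\
  g y' eta' eta' <= (1 + c2) / (1 - c2) * g y' (gr y') (gr y')
    + (g y' (gr y') (gr y') / g y (gr y) (gr y)) ^+ 2 * g y eta eta.
Proof.
move=> y'E c20 c2h /eqP gr0 [_]; rewrite -y'E => curv.
have -> : beta_FR g f y y' = g y' (gr y') (gr y') / g y (gr y) (gr y).
  by rewrite -!rnorm_sqr.
move=> lebeta ->.
have [a [a0 a1 TE normT]] := scaled_transportP Rt g y (alpha *: eta) eta.
rewrite TE; apply: metric_conjugate_direction => //.
rewrite -TE -(rnorm_sqr g y) -(rnorm_sqr g y').
by rewrite ler_sqr ?nnegrE ?sqrtr_ge0 // y'E.
Qed.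

End Step.

(** * Real sequences: harmonic divergence and limit inferior *)

Lemma series_harmonic_unbounded (R : realType) (B : R) :
  exists m, B < series harmonic m.
Proof.
apply/not_existsP => bnd; apply: (@dvg_harmonic R).
apply: nondecreasing_is_cvgn.
  by apply: nondecreasing_series => i _ _; exact: harmonic_ge0.
by exists B => _ [m _ <-]; rewrite leNgt; apply/negP; exact: bnd.
Qed.

(** Here [F], [G], [H], [S] stand for the function values, [|g_k|^2], [|eta_k|^2] and
    [<g_k, eta_k>]. Dividing the growth bound by [G k.+1 ^+ 2] makes it additive in
    [H k / G k ^+ 2]. *)
Lemma fletcher_reeves_no_lower_bound (R : realType) (c2 C e B : R)
    (F G H S : nat -> R) :
  0 <= c2 -> c2 < 1 / 2 -> 0 < C -> 0 < e ->
  (forall k, B <= F k) -> (forall k, e <= G k) -> (forall k, 0 < H k) ->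
  (forall k, (1 - c2) * `|S k + G k| <= c2 * G k) ->
  (forall k, F k.+1 <= F k - C * (S k ^+ 2 / H k)) ->
  (forall k, H k.+1 <=
     (1 + c2) / (1 - c2) * G k.+1 + (G k.+1 / G k) ^+ 2 * H k) ->
  False.
Proof.
move=> c20 c2h C0 e0 FB Ge H0 descent decr growth.
have G0 k : 0 < G k by exact: lt_le_trans (Ge k).
(* [b] bounds each increment of [H k / G k ^+ 2]; [D] dominates both its initial value and [b]. *)
pose b := (1 + c2) / (1 - c2) / e; pose D := H 0%N / G 0%N ^+ 2 + b.
(* This is [1 - c2 / (1 - c2)], the sufficient descent constant: [delta * G k <= - S k]. *)
pose delta := (1 - 2 * c2) / (1 - c2).
have delta0 : 0 < delta by rewrite divr_gt0 //; lra.
have b0 : 0 < b by rewrite !divr_gt0 //; lra.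
have D0 : 0 < D by rewrite addr_gt0 // divr_gt0 // exprn_gt0.
have r_step k : H k.+1 / G k.+1 ^+ 2 <= b + H k / G k ^+ 2.
  rewrite ler_pdivrMr ?exprn_gt0//; apply: le_trans (growth k) _.
  rewrite [leRHS]mulrDl; apply: lerD; last first.
    by rewrite le_eqVlt; apply/orP; left; apply/eqP; field; rewrite gt_eqF.
  have -> : b * G k.+1 ^+ 2 = (1 + c2) / (1 - c2) * G k.+1 * (G k.+1 / e).
    by rewrite /b; field; rewrite !gt_eqF //; lra.
  rewrite ler_peMr ?ler_pdivlMr ?mul1r // mulr_ge0 ?(ltW (G0 _)) //.
  by apply: divr_ge0; lra.
have r_le k : H k / G k ^+ 2 <= D * k.+1%:R.
  elim: k => [|k IH]; first by rewrite mulr1 /D lerDl ltW.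
  apply: le_trans (r_step k) _; rewrite -[k.+2%:R]natr1 mulrDr mulr1 addrC.
  by apply: lerD => //; rewrite /D lerDr divr_ge0 ?exprn_ge0// ltW.
(* [S k ^+ 2 / H k] is at least [delta ^+ 2] over the ratio bounded in [r_le]; [harmonic k] is the
   inverse of [k.+1], matching that bound. *)
have S_ge k : delta ^+ 2 / D * harmonic k <= S k ^+ 2 / H k.
  have SG : delta * G k <= - S k.
    rewrite /delta mulrAC ler_pdivrMr; last by lra.
    by have := ler_norm (S k + G k); have := descent k; nra.
  have -> : delta ^+ 2 / D * harmonic k = delta ^+ 2 / (D * k.+1%:R).
    by rewrite /= invfM mulrA.
  apply: (@le_trans _ _ (delta ^+ 2 / (H k / G k ^+ 2))).
    by rewrite ler_pM2l ?exprn_gt0// lef_pV2 ?posrE ?mulr_gt0 ?invr_gt0 ?exprn_gt0//.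
  rewrite invf_div mulrA ler_pM2r ?invr_gt0// -exprMn -(sqrrN (S k)).
  by rewrite ler_sqr ?nnegrE// ?(le_trans _ SG)// mulr_ge0// ltW.
have Ffall k : F k <= F 0%N - C * (delta ^+ 2 / D) * series harmonic k.
  elim: k => [|k IH]; first by rewrite /series /= big_geq // mulr0 subr0.
  apply: le_trans (decr k) _; rewrite seriesSr mulrDr opprD addrA.
  by apply: lerB => //; rewrite -mulrA ler_pM2l.
have K0 : 0 < C * (delta ^+ 2 / D).
  by apply: mulr_gt0 => //; apply: divr_gt0 => //; exact: exprn_gt0.
have [m] := series_harmonic_unbounded ((F 0%N - B) / (C * (delta ^+ 2 / D))).
rewrite ltr_pdivrMr // mulrC; have := Ffall m; have := FB m.
move: (C * _ * _) => ?; lra.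
Qed.

(** The limit inferior is the supremum of the tail infima. These are nonnegative, and a positive one
    would be an eventual positive lower bound of [u]. *)
Lemma limn_einf_eq0 (R : realType) (u : nat -> R) :
  (forall k, 0 <= u k) ->
  ~ (exists2 e, 0 < e & exists N, forall k, (N <= k)%N -> e <= u k) ->
  limn_einf (EFin \o u) = 0%E.
Proof.
move=> u0 small; rewrite limn_einf_lim.
have /cvg_lim -> // := @cvg_einfs_sup _ (EFin \o u).
apply/eqP; rewrite eq_le; apply/andP; split; last first.
  apply: (@le_trans _ _ (einfs (EFin \o u) 0%N)); last first.
    by apply: ereal_sup_ubound; exists 0%N.
  by apply: le_ereal_inf_tmp => _ [k _ <-]; rewrite lee_fin.
rewrite leNgt; apply/negP => /ereal_sup_gt[_ [N _ <-]] einf_gt0; apply: small.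
have einf_le k : (N <= k)%N -> (einfs (EFin \o u) N <= (u k)%:E)%E.
  by move=> Nk; apply: ereal_inf_lbound; exists k.
(* A positive tail infimum is not -oo, and it is not +oo since it lies below [u N]. *)
case: (einfs _ N) einf_gt0 einf_le => [e| |//] e0 le_u.
  by exists e => //; exists N => k /le_u; rewrite lee_fin.
by have := le_u N (leqnn N); rewrite leNgt ltry.
Qed.

(** * Contradiction from gradient norms bounded away from zero *)

Theorem theorem3p3 (R : realType) (n : nat) (M : smooth_manifold R n)
    (g : riemannian_metric M) (Rt : retraction M) (f : M -> R)
    (c1 c2 : R) (x : nat -> M) (eta : nat -> 'rV[R]_n) (alpha beta : nat -> R) :
  smooth_fun f ->
  has_lbound (range f) ->
  (exists2 L : R, 0 < L &
    forall (y : M) (u : 'rV[R]_n) (t : R), rnorm g y u = 1 -> 0 <= t ->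
      `|'d (f \o Rt y) (t *: u) u - 'd (f \o Rt y) 0 u| <= L * t) ->
  0 < c1 -> c1 < c2 -> c2 < 1 / 2 ->
  rcg_iteration g Rt f x eta alpha beta ->
  (forall k, grad g f (x k) <> 0 ->
    strong_wolfe g Rt f c1 c2 (x k) (eta k) (alpha k)) ->
  (forall k, grad g f (x k) <> 0 ->
    `|beta k.+1| <= beta_FR g f (x k) (x k.+1)) ->
  limn_einf (fun k => (rnorm g (x k) (grad g f (x k)))%:E) = 0%E.
Proof.
move=> fs [B fB] [L L0 lip] c1_gt0 c12 c2h [eta0 iter] wolfe FR.
apply: limn_einf_eq0 => [k|[e e0 [N Ne]]]; first exact: sqrtr_ge0.
(* A vanishing gradient would freeze the sequence and persist at index [k + N], against the lower
   bound [e]. So the iteration never stops. *)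
have gr0 k : grad g f (x k) <> 0.
  move=> gk0; suff gi0 i : grad g f (x (k + i)%N) = 0.
    have := Ne (k + N)%N (leq_addl _ _).
    by rewrite gi0 /rnorm metric0l sqrtr0 leNgt e0.
  elim: i => [|i IH]; first by rewrite addn0.
  by rewrite addnS (iter _).1.
have c20 : 0 <= c2 by lra.
pose G k := g (x k) (grad g f (x k)) (grad g f (x k)).
pose S k := g (x k) (grad g f (x k)) (eta k).
(* The induction starts at 0, not at [N]: there [eta 0 = - g_0] makes [S 0 + G 0] vanish. *)
have descent k : (1 - c2) * `|S k + G k| <= c2 * G k.
  elim: k => [|k IH].
    by rewrite /S /G eta0 metricNr addNr normr0 mulr0 mulr_ge0 ?metric_ge0.
  have [_ xS etaS] := (iter k).2 (gr0 k).
  by have [] := rcg_next_direction xS c20 c2h (gr0 k) (wolfe k (gr0 k))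
    (FR k (gr0 k)) etaS IH.
have G0 k : 0 < G k by apply: metric_gt0; apply/eqP.
have S0 k : S k < 0.
  by have := ler_norm (S k + G k); have := descent k; have := G0 k; nra.
have etaN0 k : eta k != 0.
  apply: contraTneq (S0 k) => eta_0.
  by rewrite /S eta_0 Defs.metric_sym metric0l ltxx.
pose C := c1 * (1 - c2) / L.
have C0 : 0 < C by rewrite divr_gt0 // mulr_gt0 //; lra.
(* All sequences are shifted by [N], where the lower bound on the gradient begins; it becomes
   [e ^+ 2] because [G] is a squared norm. *)
apply: (@fletcher_reeves_no_lower_bound R c2 C (e ^+ 2) B
  (fun k => f (x (N + k)%N)) (fun k => G (N + k)%N)
  (fun k => g (x (N + k)%N) (eta (N + k)%N) (eta (N + k)%N))
  (fun k => S (N + k)%N) c20 c2h C0).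
- by rewrite exprn_gt0.
- by move=> k; apply: fB; exists (x (N + k)%N).
- move=> k; rewrite /G -rnorm_sqr ler_sqr ?nnegrE ?sqrtr_ge0 ?(ltW e0)//.
  by apply: Ne; exact: leq_addr.
- by move=> k; exact: metric_gt0.
- by move=> k; exact: descent.
- move=> k; rewrite addnS; move: (N + k)%N => {}k.
  have [alpha0 -> _] := (iter k).2 (gr0 k).
  exact: (wolfe_decrease fs L0 (lip (x k)) c1_gt0 alpha0 (S0 k)
    (wolfe k (gr0 k))).
move=> k; rewrite addnS; move: (N + k)%N => {}k.
have [_ xS etaS] := (iter k).2 (gr0 k).
by have [] := rcg_next_direction xS c20 c2h (gr0 k) (wolfe k (gr0 k))
  (FR k (gr0 k)) etaS (descent k).
Qed.
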